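(* Let $\nu\ge7$ and $n=2^\nu$. Then the alternating group $\mathrm{Alt}((\mathbb{F}_2)^\nu)$ on the $n$-element set $(\mathbb{F}_2)^\nu$ contains an element $\eta$ of even order with $\mathrm{o}(\eta)>e^{\sqrt{(1/4)\,n\ln n}}$.
   Context: $\mathrm{o}(\eta)$ denotes the order of the permutation $\eta$. *)

(* Defs.v *)
From mathcomp Require Import all_boot all_order all_fingroup all_algebra all_solvable.
From Stdlib Require Import Reals.

(* Main.v *)
(** Let [L m] be the least common multiple of [1, ..., m].  Nair's argument with
    the Leibniz harmonic triangle gives [2 ^ m <= L m] for [m >= 9].  Put
    [t = sqrt (n ln n / 4)] and let [y] be maximal with [ln (L y) <= t], so that
    [y <= Y] for [Y = t / ln 2].  Take disjoint cycles whose lengths are the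
    maximal prime powers [q] dividing [L y], one more cycle of length [y + 1],
    and, if this permutation is odd, a transposition of two remaining points.
    The order is a multiple of [L (y + 1)], hence even and larger than [exp t].
    These points are available because [q / ln q <= Y / ln Y] yields
    [sum q <= Y t / ln Y <= n / (2 ln 2)], and [Y + 3] is less than what is
    left; only a lower Chebyshev bound is needed. *)

Require Import Defs.
From Stdlib Require Import Reals Lra.
From mathcomp Require Import all_boot all_order all_fingroup all_algebra all_solvable.
From mathcomp Require Import zify.

Set Implicit Arguments.
Unset Strict Implicit.
Unset Printing Implicit Defensive.

(** * Nair's lower bound for the least common multiple *)

Definition lcm_upto (n : nat) : nat := \big[lcmn/1]_(1 <= i < n.+1) i.

Lemma lcm_uptoS n : lcm_upto n.+1 = lcmn (lcm_upto n) n.+1.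
Proof. by rewrite /lcm_upto big_nat_recr. Qed.

Lemma lcm_upto_gt0 n : 0 < lcm_upto n.
Proof.
elim: n => [|n IH]; first by rewrite /lcm_upto big_geq.
by rewrite lcm_uptoS lcmn_gt0 IH.
Qed.

Lemma dvdn_lcm_upto m n : m <= n -> lcm_upto m %| lcm_upto n.
Proof.
elim: n => [|n IH]; first by rewrite leqn0 => /eqP->.
rewrite leq_eqVlt => /orP[/eqP-> //|/IH mn].
by rewrite lcm_uptoS (dvdn_trans mn) ?dvdn_lcml.
Qed.

Lemma dvdn_lcm_upto_small i n : 0 < i <= n -> i %| lcm_upto n.
Proof.
case: i => // i /= /dvdn_lcm_upto; apply: dvdn_trans.
by rewrite lcm_uptoS dvdn_lcmr.
Qed.

(** Valuations turn least common multiples into maxima, so the [p]-part is attained by some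
    [i <= n]. This caps the cycle lengths. *)
Lemma partn_lcm_upto_le p n : prime p -> 0 < n -> (lcm_upto n)`_p <= n.
Proof.
move=> p_pr; elim: n => // n IH _.
rewrite p_part lcm_uptoS logn_lcm ?lcm_upto_gt0 //.
rewrite /maxn; case: ifP => _; first by rewrite -p_part dvdn_leq ?dvdn_part.
case: (posnP n) => [->|n0]; first by rewrite /lcm_upto big_geq ?logn1.
by rewrite -p_part (leq_trans (IH n0)).
Qed.

(* The hypothesis says 1/a = 1/b - 1/c. *)
Lemma dvdn_harmonic_diff a b c M :
  0 < b -> 0 < c -> a * c = b * c + a * b -> b %| M -> c %| M -> a %| M.
Proof.
move=> b0 c0 eq_abc /dvdnP[u Mb] /dvdnP[v Mc].
suff E : a * u = M + a * v.
  by rewrite -(dvdn_addl _ (dvdn_mulr v (dvdnn a))) -E dvdn_mulr.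
have := congr1 (muln M) eq_abc; rewrite mulnDr.
rewrite [in M * (a * c)]Mb [in M * (a * b)]Mc => E.
apply/eqP; rewrite -(eqn_pmul2r (_ : 0 < b * c)) ?muln_gt0 ?b0 //; apply/eqP.
nia.
Qed.

(* Nair's argument: the numbers k * 'C(n, k) are the denominators of the
   Leibniz harmonic triangle. *)
Lemma dvdn_bin_lcm_upto k n : k < n -> k.+1 * 'C(n, k.+1) %| lcm_upto n.
Proof.
elim: k n => [|k IH] n kn; first by rewrite bin1 mul1n dvdn_lcm_upto_small ?kn /=.
case: n kn => // n kn; rewrite ltnS in kn.
(* An entry of the triangle is a difference of two entries of the preceding diagonal, which the
   induction on [k] covers. *)
apply: (dvdn_harmonic_diff (b := k.+1 * 'C(n, k.+1)) (c := k.+1 * 'C(n.+1, k.+1))).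
- by rewrite muln_gt0 bin_gt0.
- by rewrite muln_gt0 bin_gt0 (leq_trans kn).
- have := mul_bin_diag n.+1 k.+1; have := mul_bin_diag n.+1 k.
  rewrite /= => E1 <-; rewrite -E1; have := congr1 (muln (n.+1 * 'C(n, k.+1))) E1; rewrite binS; lia.
- exact: dvdn_trans (IH _ kn) (dvdn_lcm_upto (leqnSn n)).
- by apply: IH; rewrite (leq_trans kn).
Qed.

(** From [m] to [m.+1] the right side grows by the factor 2(2m+3)/(m+1) >= 4. *)
Lemma central_bin_lower m : 4 ^ m <= m.*2.+1 * 'C(m.*2, m).
Proof.
elim: m => [|m IH]; first by rewrite bin0.
have E1 := mul_bin_diag m.*2.+2 m.
have E2 := mul_bin_diag m.*2.+1 m.
rewrite /= in E1 E2.
have E3 : 'C(m.*2.+1, m) = 'C(m.*2.+1, m.+1).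
  by rewrite -bin_sub; [congr 'C(_, _); lia | lia].
rewrite doubleS expnS; rewrite E3 in E1.
rewrite -(leq_pmul2l (ltn0Sn m)).
have -> : m.+1 * (m.*2.+3 * 'C(m.*2.+2, m.+1)) = m.*2.+3 * 2 * (m.*2.+1 * 'C(m.*2, m)).
  by rewrite mulnCA -E1 E2; nia.
rewrite mulnA; apply: leq_mul => //; lia.
Qed.

(** With B the central binomial coefficient, both mB and (2m+1)B divide the least common multiple;
    as m and 2m+1 are coprime, so does m(2m+1)B. *)
Lemma lcm_upto_odd_lower m : 0 < m -> m * 4 ^ m <= lcm_upto m.*2.+1.
Proof.
move=> m0; have mm : m < m.*2.+1 by lia.
have D1 := dvdn_bin_lcm_upto mm; rewrite -mul_bin_diag in D1.
have D2 : m * 'C(m.*2, m) %| lcm_upto m.*2.+1.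
  apply: dvdn_trans (dvdn_lcm_upto (leqnSn _)).
  by case: m m0 {mm D1} => // m _; apply: dvdn_bin_lcm_upto; lia.
have co : coprime m m.*2.+1.
  by rewrite -mul2n -addn1 /coprime gcdnMDl gcdn1.
apply: leq_trans (_ : m * (m.*2.+1 * 'C(m.*2, m)) <= _).
  by rewrite leq_mul2l central_bin_lower orbT.
apply: dvdn_leq (lcm_upto_gt0 _) _.
have C0 : 0 < 'C(m.*2, m) by rewrite bin_gt0; lia.
move: D1 D2 => /dvdnP[u ->] /dvdnP[v E].
rewrite dvdn_pmul2r ?muln_gt0 //= -(Gauss_dvdl _ co).
apply/dvdnP; exists v; apply/eqP; rewrite -(eqn_pmul2r C0); apply/eqP; rewrite -!mulnA; exact: E.
Qed.

Lemma lcm_upto_lower n : 9 <= n -> 2 ^ n <= lcm_upto n.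
Proof.
(* Now [n] is 2m+1 or 2m+2, and m >= 4 supplies the missing factor 4. *)
move=> n9; set m := n.-1./2.
have /andP[H1 H2] : (m.*2.+1 <= n) && (n <= m.*2.+2) by rewrite /m; lia.
have m4 : 4 <= m by rewrite /m; lia.
have L := lcm_upto_odd_lower (leq_trans (isT : 0 < 4) m4).
apply: leq_trans (_ : 2 ^ m.*2.+2 <= _); first by rewrite leq_exp2l.
have D := dvdn_leq (lcm_upto_gt0 _) (dvdn_lcm_upto H1).
apply: leq_trans D; apply: leq_trans L.
by rewrite !expnS -mul2n expnM mulnA; apply: leq_mul.
Qed.

(** * Permutations with cycles of prescribed lengths *)

Section DisjointCycles.
Import GroupScope.

Lemma perm_on_expgn (T : finType) (A : {set T}) (s : {perm T}) k : perm_on A s -> perm_on A (s ^+ k).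
Proof.
move=> sA; elim: k => [|k IH]; first by rewrite expg0 perm_on1.
by rewrite expgS perm_onM.
Qed.

(** If the product of the [k]-th powers is trivial, disjoint supports force each power to be
    trivial. *)
Lemma dvdn_order_disjoint (T : finType) (A B : {set T}) (s c : {perm T}) :
    perm_on A s -> perm_on B c -> [disjoint A & B] ->
  (#[s] %| #[s * c]) && (#[c] %| #[s * c]).
Proof.
move=> sA cB dAB.
have cAB : commute s c.
  by apply: perm_onC sA cB _; exact: dAB.
have := expg_order (s * c); set k := #[_ * _]; rewrite expgMn // => E.
have sk := perm_on_expgn k sA; have ck := perm_on_expgn k cB.
have s1 : s ^+ k = 1.
  apply/permP=> x; rewrite perm1.
  have [xA|/(out_perm sk) //] := boolP (x \in A).
  have skA : (s ^+ k) x \in A by rewrite perm_closed.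
  have /permP/(_ x) := E; rewrite permM perm1 (out_perm ck) //.
  by rewrite (disjointFr dAB skA).
by rewrite !order_dvdn s1; move: E; rewrite s1 mul1g => ->; rewrite eqxx.
Qed.

(** The witness sends each point to its successor in the enumeration of [A], so [A] is a single
    orbit. *)
Lemma exists_cycle_on (T : finType) (A : {set T}) :
  A != set0 -> exists2 c : {perm T}, perm_on A c & #|A| %| #[c].
Proof.
move=> /set0Pn[x xA].
have uA := enum_uniq (mem A).
pose c := perm (can_inj (prev_next uA)).
have xE : x \in enum A by rewrite mem_enum.
exists c.
  apply/subsetP=> y; rewrite inE permE; apply: contraR => yA.
  by rewrite next_nth mem_enum (negbTE yA).
suff -> : #|A| = #|porbit c x| by rewrite porbitE dvdn_orbit.
rewrite cardE -(order_cycle (cycle_next uA) uA xE).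
have iter_c k y : (c ^+ k) y = iter k (next (enum A)) y.
  by rewrite permX; apply: eq_iter => z; rewrite permE.
apply: eq_card => y; apply/idP/porbitP => [cxy|[k ->]].
  by exists (findex (next (enum A)) x y); rewrite iter_c iter_findex.
by rewrite iter_c; apply: fconnect_iter.
Qed.

(** Each length takes its own block out of [A]. Divisibility suffices for a lower bound on the
    order. *)
Lemma exists_perm_dvdn_order (T : finType) (ls : seq nat) (A : {set T}) :
    all (leq 1) ls -> (sumn ls <= #|A|)%N ->
  exists2 s : {perm T}, perm_on A s & all (fun l => l %| #[s]) ls.
Proof.
elim: ls A => [|l ls IH] A /=; first by exists 1; rewrite ?perm_on1.
case/andP=> l0 ls0 lA.
have [B BA cB] : exists2 B : {set T}, B \subset A & #|B| = l.
  have lA' : (l <= #|A|)%N by rewrite (leq_trans _ lA) ?leq_addr.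
  exists [set x in take l (enum A)].
    by apply/subsetP=> x; rewrite inE => /mem_take; rewrite mem_enum.
  rewrite cardsE (card_uniqP _) ?take_uniq ?enum_uniq // size_take -cardE.
  by case: ltngtP lA'.
have [s sA sls] : exists2 s : {perm T}, perm_on (A :\: B) s &
     all (fun l => l %| #[s]) ls.
  by apply: IH => //; rewrite cardsD (setIidPr BA) cB leq_subRL // -cB subset_leq_card.
have B0 : B != set0 by rewrite -card_gt0 cB.
have [c cOn cl] := exists_cycle_on B0.
have dis : [disjoint A :\: B & B] by rewrite -setI_eq0 setDE -setIA [~: B :&: B]setIC setICr setI0.
have /andP[ds dc] := dvdn_order_disjoint sA cOn dis.
exists (s * c).
  rewrite perm_onM //.
    by apply: subset_trans sA _; apply: subsetDl.
  exact: subset_trans cOn BA.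
rewrite -cB (dvdn_trans cl dc) /=.
by apply: sub_all sls => k /dvdn_trans; apply.
Qed.

End DisjointCycles.


(** * Real estimates: the cycles fit into [n] points *)

Section Analysis.
Local Open Scope R_scope.

Lemma ln_le_sub1 x : 0 < x -> ln x <= x - 1.
Proof. by move=> x0; have := exp_ineq1_le (ln x); rewrite exp_ln //; lra. Qed.

Lemma ln_le x y : 0 < x -> x <= y -> ln x <= ln y.
Proof.
move=> x0 [xy|->]; last exact: Rle_refl.
by apply: Rlt_le; apply: ln_increasing.
Qed.

(** Follows from (15/14)^10 <= 2 and ln(15/14) >= 1/15. *)
Lemma ln2_lower : 2 / 3 <= ln 2.
Proof.
have H := ln_le_sub1 (_ : 0 < 14 / 15).
have E : ln (15 / 14) = - ln (14 / 15).
  rewrite -ln_Rinv; last lra. by congr ln; field.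
have P : INR 10 * ln (15 / 14) <= ln 2.
  rewrite -ln_pow; last lra.
  by apply: ln_le; simpl; lra.
have {}H := H ltac:(lra).
by rewrite E /= in P; lra.
Qed.

(* This is the monotonicity of x / ln x for x >= e; at q = 2 it survives
   because 2 / ln 2 = 4 / ln 4. *)
Lemma mul_ln_le (q Y : R) : q = 2 \/ 3 <= q -> q <= Y -> 4 <= Y -> q * ln Y <= Y * ln q.
Proof.
have big r : 3 <= r -> r <= Y -> r * ln Y <= Y * ln r.
  move=> r3 rY.
  have lnr : 1 <= ln r.
    rewrite -(ln_exp 1); apply: ln_le; first exact: exp_pos.
    by have := exp_le_3; lra.
  have Yr : 1 <= Y / r by apply: (Rmult_le_reg_r r); [lra | field_simplify; lra].
  have H := ln_le_sub1 (_ : 0 < Y / r); have {}H := H ltac:(lra).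
  rewrite /Rdiv ln_mult in H; [|lra|by apply: Rinv_0_lt_compat; lra].
  rewrite ln_Rinv in H; last lra.
  have H2 : ln Y <= Y / r * ln r by rewrite /Rdiv in Yr *; nra.
  have -> : Y * ln r = r * (Y / r * ln r) by field; lra.
  by apply: Rmult_le_compat_l; lra.
case=> [-> _ Y4|]; last by move=> q3 qY _; exact: big.
have := big 4 ltac:(lra) Y4.
have -> : ln 4 = 2 * ln 2 by rewrite (_ : 4 = 2 * 2) ?ln_mult; lra.
lra.
Qed.

Lemma sumn_mul_ln_le (s : seq nat) (Y : R) : 4 <= Y ->
    (forall q, q \in s -> (1 < q)%N /\ INR q <= Y) ->
  INR (sumn s) * ln Y <= Y * ln (INR (\prod_(q <- s) q)).
Proof.
move=> Y4; elim: s => [|q s IH] sY; first by rewrite big_nil /= ln_1; lra.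
have [q1 qY] := sY q (mem_head _ _).
have prod_gt0 : (0 < \prod_(r <- s) r)%N.
  rewrite big_seq; apply: prodn_cond_gt0 => r rs.
  by have [/ltnW] := sY r (mem_behead (s := q :: s) rs).
rewrite big_cons /= plus_INR mult_INR ln_mult; last first.
- by apply: lt_0_INR; apply/ltP.
- by apply: lt_0_INR; apply/ltP; rewrite ltnW.
have {}IH := IH (fun r rs => sY r (mem_behead (s := q :: s) rs)).
have q23 : INR q = 2 \/ 3 <= INR q.
  case: (ltngtP q 2) q1 => // [q3 _|-> _]; last by left.
  by right; have := le_INR 3 q (leP q3); rewrite /=; lra.
by have := mul_ln_le q23 qY Y4; lra.
Qed.

Lemma INR_expn2 k : INR (2 ^ k)%N = 2 ^ k.
Proof. by elim: k => //= k IHk; rewrite expnS mult_INR IHk /=; lra. Qed.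

Lemma mul18_le_expn2 nu : (7 <= nu)%N -> (18 * nu <= 2 ^ nu)%N.
Proof.
elim: nu => // nu IH; rewrite leq_eqVlt => /orP[/eqP<- //|nu7].
by have := IH nu7; rewrite expnS; lia.
Qed.

(* [t] is the logarithm of the target order and [Y = t / ln 2] bounds the
   cycle lengths. *)
Lemma cycle_lengths_bound (nu : nat) (t Y : R) : (7 <= nu)%N ->
    t = sqrt (/ INR 4 * (INR (2 ^ nu) * ln (INR (2 ^ nu)))) -> Y = t / ln 2 ->
  9 <= Y /\ forall S, S * ln Y <= Y * t -> S + Y + 3 <= INR (2 ^ nu).
Proof.
move=> nu7 tE YE; set n := INR (2 ^ nu) in tE *.
have l2 := ln2_lower.
have l2' : ln 2 <= 1 by have := @ln_le_sub1 2 ltac:(lra); lra.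
have nuR : 7 <= INR nu by have := le_INR 7 nu (leP nu7); rewrite /=; lra.
have nE : ln n = INR nu * ln 2.
  by rewrite /n INR_expn2 ln_pow //; lra.
have n18 : 18 * INR nu <= n.
  have := le_INR _ _ (leP (mul18_le_expn2 nu7)); rewrite mult_INR -/n.
  by rewrite (INR_IZR_INZ 18).
have lnn0 : 0 < ln n by rewrite nE; nra.
have tt : t * t = n * ln n / 4.
  rewrite tE sqrt_sqrt; first by rewrite /=; field.
  by apply: Rmult_le_pos; [rewrite /=; lra | nra].
have t0 : 0 < t by rewrite tE; apply: sqrt_lt_R0; rewrite /=; nra.
have Yt : Y * ln 2 = t by rewrite YE; field; lra.
have Y0 : 0 < Y by nra.
have YY : Y * Y * ln 2 = n * INR nu / 4.
  apply: (Rmult_eq_reg_r (ln 2)); last lra.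
  rewrite (_ : Y * Y * ln 2 * ln 2 = (Y * ln 2) * (Y * ln 2)); last ring.
  by rewrite Yt tt nE; field.
(* Here nu >= 7 and ln 2 <= 1 give nu / (4 ln 2) >= 1. *)
have nY : n <= Y * Y by nra.
have Y9 : 9 <= Y by nra.
split=> // S SY.
have lnY : ln n <= 2 * ln Y.
  have -> : 2 * ln Y = ln (Y * Y) by rewrite ln_mult //; ring.
  by apply: ln_le => //; nra.
have lnY0 : 0 < ln Y by lra.
(* Since ln 2 >= 2/3, Y t <= (3/8) n ln n, and ln n <= 2 ln Y. *)
have S34 : S <= 3 / 4 * n.
  apply: (Rmult_le_reg_r (ln Y)) => //; apply: (Rle_trans _ _ _ SY).
  have E : Y * t * ln 2 = n * ln n / 4 by rewrite -tt -{2}Yt; ring.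
  have H1 : 2 / 3 * (Y * t) <= Y * t * ln 2 by nra.
  have H2 : n * ln n <= n * (2 * ln Y) by nra.
  lra.
have n126 : 126 <= n by lra.
(* Otherwise (n/4 - 3)^2 <= (3/8) n nu <= n^2/48, which fails for n >= 126. *)
have : Y <= n / 4 - 3.
  apply: Rnot_lt_le => H.
  have : (n / 4 - 3) * (n / 4 - 3) <= Y * Y by nra.
  have : Y * Y <= 3 / 8 * (n * INR nu) by nra.
  nra.
lra.
Qed.

End Analysis.

(** * Prime-power parts and the passage to even permutations *)

Definition prime_parts (n : nat) : seq nat := [seq n`_p | p : nat <- primes n].

Lemma prod_prime_parts n : 0 < n -> \prod_(q <- prime_parts n) q = n.
Proof.
move=> n0; rewrite [RHS]prod_prime_decomp // prime_decompE !big_map.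
by apply: eq_bigr => p _; rewrite p_part.
Qed.

Lemma dvdn_prime_parts n m :
  0 < n -> all (fun q => q %| m) (prime_parts n) -> n %| m.
Proof.
move=> n0 /allP dvd_m; apply/dvdn_partP => // p p_n.
by apply/dvd_m/map_f.
Qed.

Lemma prime_parts_gt1 n q : q \in prime_parts n -> 1 < q.
Proof.
case/mapP=> p; rewrite mem_primes => /and3P[p_pr n0 p_n] ->.
by rewrite p_part -(exp1n (logn p n)) ltn_exp2r ?prime_gt1 // logn_gt0 mem_primes p_pr n0.
Qed.

Lemma prime_parts_lcm_upto_le n q : q \in prime_parts (lcm_upto n) -> q <= n.
Proof.
case/mapP=> p; rewrite mem_primes => /and3P[p_pr _ p_n] ->.
case: n p_n => [|n _]; last exact: partn_lcm_upto_le.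
by rewrite /lcm_upto big_geq // Euclid_dvd1.
Qed.

(** Two points stay fixed in reserve; swapping them repairs the parity without losing any divisor of
    the order. *)
Lemma exists_Alt_dvdn_order (T : finType) (ls : seq nat) :
    all (leq 1) ls -> sumn ls + 2 <= #|T| ->
  exists2 s : {perm T}, s \in Alt T & all (fun l => l %| #[s]%g) ls.
Proof.
move=> ls0 lsT.
have [x [y [xy cardD]]] : exists x y : T, x != y /\ sumn ls <= #|~: [set x; y]|.
  have /card_gt1P[x [y [_ _ xy]]] : 1 < #|T| by apply: leq_trans lsT; lia.
  exists x, y; split=> //.
  by have := cardsC [set x; y]; rewrite cards2 xy; lia.
have [s sD dvd_s] := exists_perm_dvdn_order ls0 cardD.
have [odd_s|even_s] := boolP (odd_perm s); last first.
  by exists s => //; rewrite Alt_even.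
have dis : [disjoint ~: [set x; y] & [set x; y]].
  by rewrite disjoint_sym -setI_eq0 setICr.
have /andP[ds _] := dvdn_order_disjoint sD (tperm_on x y) dis.
exists (s * tperm x y)%g.
  by rewrite Alt_even odd_permM odd_tperm xy odd_s.
by apply: sub_all dvd_s => l /dvdn_trans; apply.
Qed.

(** * Choice of [y] and the final construction *)

Section Crossing.
Local Open Scope R_scope.

Lemma ln_lcm_upto_lower m : (9 <= m)%N -> INR m * ln 2 <= ln (INR (lcm_upto m)).
Proof.
move=> m9; rewrite -ln_pow; last lra.
rewrite -INR_expn2; apply: ln_le.
  by rewrite INR_expn2; apply: pow_lt; lra.
by apply: le_INR; apply/leP; apply: lcm_upto_lower.
Qed.

(** The bound 2^m <= [lcm_upto m] makes the logarithm unbounded. The least index exceeding [t] is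
    positive because [lcm_upto 0] is 1. *)
Lemma exists_lcm_upto_crossing (t : R) : 0 <= t ->
  exists y : nat, ln (INR (lcm_upto y)) <= t < ln (INR (lcm_upto y.+1)).
Proof.
move=> t0; pose P m := is_left (Rlt_dec t (ln (INR (lcm_upto m)))).
have PP m : reflect (t < ln (INR (lcm_upto m))) (P m).
  by rewrite /P; case: Rlt_dec => H; constructor.
have exP : exists m, P m.
  have [k kt] := INR_unbounded (t / ln 2).
  exists (k + 9)%N; apply/PP; have l2 := ln2_lower.
  apply: Rlt_le_trans (ln_lcm_upto_lower (leq_addl k 9)).
  have -> : t = t / ln 2 * ln 2 by field; lra.
  apply: Rmult_lt_compat_r; first lra.
  by apply: Rlt_le_trans kt _; apply: le_INR; apply/leP; rewrite leq_addr.
case: (ex_minnP exP) => -[/PP|y /PP Py min_y].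
  by rewrite /lcm_upto big_geq //= ln_1; lra.
exists y; split=> //; apply: Rnot_lt_le => /PP /min_y.
by rewrite ltnn.
Qed.

End Crossing.

(* The n-element set (F_2)^nu is 'rV['F_2]_nu; Alt of it is Alt ('rV['F_2]_nu). *)
Theorem mainTheorem13 (nu : nat) (n : nat) :
  (7 <= nu)%N -> n = expn 2 nu ->
  exists eta : {perm 'rV['F_2]_nu},
    [/\ eta \in Alt ('rV['F_2]_nu), ~~ odd #[eta]%g &
      (Rlt (exp (sqrt (Rmult (Rinv (INR 4)) (Rmult (INR n) (ln (INR n)))))) (INR #[eta]%g))].
Proof.
move=> nu7 ->; set t := sqrt _; pose Y := Rdiv t (ln (IZR 2)).
have [Y9 bound] := cycle_lengths_bound nu7 (erefl t) (erefl Y).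
have [y [Ly LyS]] := exists_lcm_upto_crossing (sqrt_pos _ : Rle 0 t).
have l2 := ln2_lower.
(* Nair's bound needs y >= 9; smaller [y] are covered by 9 <= Y. *)
have yY : Rle (INR y) Y.
  have [y9|y9] := leqP 9 y; last first.
    apply: Rle_trans Y9; have := le_INR _ _ (leP (ltnW y9)).
    by rewrite [INR 9]INR_IZR_INZ.
  apply: (Rmult_le_reg_r (ln (IZR 2))); first lra.
  rewrite /Y /Rdiv Rmult_assoc Rinv_l; last lra.
  by have := ln_lcm_upto_lower y9; lra.
pose s := prime_parts (lcm_upto y).
have sY q : q \in s -> (1 < q)%N /\ Rle (INR q) Y.
  move=> qs; split; first exact: prime_parts_gt1 qs.
  apply: Rle_trans yY; apply: le_INR; apply/leP.
  exact: prime_parts_lcm_upto_le.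
(* The extra cycle and the two reserved points cost y + 3, the slack granted by [bound]. *)
have sum_s : (sumn (y.+1 :: s) + 2 <= #|{: 'rV['F_2]_nu}|)%N.
  rewrite card_mx card_Fp // mul1n.
  have Y4 : Rle (IZR 4) Y by lra.
  have := sumn_mul_ln_le Y4 sY; rewrite prod_prime_parts ?lcm_upto_gt0 // => H.
  have {}H : Rle (Rmult (INR (sumn s)) (ln Y)) (Rmult Y t).
    by apply: Rle_trans H _; apply: Rmult_le_compat_l => //; lra.
  have {}H := bound _ H.
  have : Rle (INR (sumn s + y + 3)) (INR (2 ^ nu)).
    by rewrite !plus_INR [INR 3]INR_IZR_INZ /=; lra.
  move/INR_le/leP; rewrite /=; lia.
have s_gt0 : all (leq 1) (y.+1 :: s).
  by apply/allP=> q; rewrite inE => /predU1P[-> //|/sY[/ltnW]].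
have [eta eta_Alt /= /andP[y_dvd s_dvd]] := exists_Alt_dvdn_order s_gt0 sum_s.
have L_dvd : lcm_upto y.+1 %| #[eta]%g.
  by rewrite lcm_uptoS dvdn_lcm y_dvd (dvdn_prime_parts (lcm_upto_gt0 y) s_dvd).
(* If [y] were 0, [lcm_upto 1] = 1 would have logarithm 0, not above [t]. Hence 2 divides
   [lcm_upto y.+1]. *)
have y_gt0 : (0 < y)%N.
  case: (y) LyS => //; rewrite lcm_uptoS /lcm_upto big_geq // /= ln_1.
  by have := sqrt_pos _ : Rle 0 t; lra.
exists eta; split=> //.
  rewrite -dvdn2; apply: dvdn_trans L_dvd.
  by apply: dvdn_lcm_upto_small.
apply: Rlt_le_trans (_ : Rle (INR (lcm_upto y.+1)) _).
  rewrite -[INR (lcm_upto _)]exp_ln; first exact: exp_increasing.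
  by apply: lt_0_INR; apply/ltP/lcm_upto_gt0.
by apply: le_INR; apply/leP; apply: dvdn_leq L_dvd.
Qed.
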